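(* Let $\mathcal G$ be a class of graphs that is polynomially $\chi$-bounded. Then $\mathcal G^\&$ is polynomially $\chi$-bounded.
   Context: All graphs are finite, simple and undirected; $\omega(G)$ is the clique number and $\chi(G)$ the chromatic number of $G$. A class $\mathcal G$ of graphs is $\chi$-bounded if there is a function $f$ such that for every $G\in\mathcal G$ and every induced subgraph $H$ of $G$, $\chi(H)\le f(\omega(H))$; it is polynomially $\chi$-bounded if $f$ can be taken to be a polynomial. For graphs $G_1,G_2$ with $|V(G_1)|,|V(G_2)|\ge 3$ and $V(G_1)\cap V(G_2)=\emptyset$, and vertices $v_1\in V(G_1)$, $v_2\in V(G_2)$, the $1$-join of $(G_1,v_1)$ and $(G_2,v_2)$ is the graph obtained from the disjoint union of $G_1$ and $G_2$ by deleting $v_1$ and $v_2$ and adding all edges between every neighbor of $v_1$ in $G_1$ and every neighbor of $v_2$ in $G_2$. For a class $\mathcal G$, $\mathcal G^\&$ denotes its closure under disjoint union and $1$-join. *)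

(* Defs.v *)
From mathcomp Require Import all_boot all_algebra reals.
Set Implicit Arguments.
Unset Strict Implicit.
Unset Printing Implicit Defensive.

Local Open Scope ring_scope.

Record sgraph := SGraph {
  vertex :> finType;
  adj : rel vertex;
  adj_sym : symmetric adj;
  adj_irrefl : irreflexive adj
}.

Definition graph_iso (G H : sgraph) : Prop :=
  exists2 f : G -> H, bijective f & forall x y, adj (f x) (f y) = adj x y.

Section Induced.
Variables (G : sgraph) (S : {set G}).

Definition induced_adj : rel {x : G | x \in S} :=
  fun x y => adj (val x) (val y).

Lemma induced_adj_sym : symmetric induced_adj.
Proof. by move=> x y; apply: adj_sym. Qed.

Lemma induced_adj_irrefl : irreflexive induced_adj.
Proof. by move=> x; apply: adj_irrefl. Qed.

Definition induced : sgraph := SGraph induced_adj_sym induced_adj_irrefl.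
End Induced.

Section Invariants.
Variable G : sgraph.

Definition clique (K : {set G}) : bool :=
  [forall x in K, forall y in K, (x != y) ==> adj x y].

Definition clique_number : nat := \max_(K : {set G} | clique K) #|K|.

Definition proper_coloring (k : nat) (c : {ffun G -> 'I_k}) : bool :=
  [forall x, forall y, adj x y ==> (c x != c y)].

Definition colorable (k : nat) : bool :=
  [exists c : {ffun G -> 'I_k}, proper_coloring c].

Lemma colorable_exists : exists k, colorable k.
Proof.
exists #|G|; apply/existsP; exists [ffun x => enum_rank x].
apply/forallP=> x; apply/forallP=> y; apply/implyP=> xy.
by rewrite !ffunE (inj_eq enum_rank_inj); apply: contraTneq xy => ->;
   rewrite adj_irrefl.
Qed.

Definition chromatic_number : nat := ex_minn colorable_exists.
End Invariants.

Section DisjointUnion.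
Variables G1 G2 : sgraph.

Definition dunion_adj : rel (G1 + G2)%type := fun x y =>
  match x, y with
  | inl a, inl b => adj a b
  | inr a, inr b => adj a b
  | _, _ => false
  end.

Lemma dunion_adj_sym : symmetric dunion_adj.
Proof. by move=> [a|a] [b|b] //=; apply: adj_sym. Qed.

Lemma dunion_adj_irrefl : irreflexive dunion_adj.
Proof. by move=> [a|a] /=; apply: adj_irrefl. Qed.

Definition dunion : sgraph := SGraph dunion_adj_sym dunion_adj_irrefl.
End DisjointUnion.

Section OneJoin.
Variables (G1 : sgraph) (v1 : G1) (G2 : sgraph) (v2 : G2).

Definition linked_adj : rel (G1 + G2)%type := fun x y =>
  match x, y with
  | inl a, inl b => adj a b
  | inr a, inr b => adj a b
  | inl a, inr b => adj v1 a && adj v2 b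
  | inr b, inl a => adj v1 a && adj v2 b
  end.

Lemma linked_adj_sym : symmetric linked_adj.
Proof. by move=> [a|a] [b|b] //=; apply: adj_sym. Qed.

Lemma linked_adj_irrefl : irreflexive linked_adj.
Proof. by move=> [a|a] /=; apply: adj_irrefl. Qed.

Definition linked : sgraph := SGraph linked_adj_sym linked_adj_irrefl.

Definition one_join : sgraph :=
  @induced linked (~: [set inl v1; inr v2]).
End OneJoin.

Definition graph_class := sgraph -> Prop.

(* Disjointness of vertex sets is modelled by the sum type, so a disjoint union
   or 1-join is only determined up to isomorphism; hence [amp_iso]. *)
Inductive amp_closure (C : graph_class) : graph_class :=
| amp_base (G : sgraph) : C G -> amp_closure C G
| amp_iso (G H : sgraph) : graph_iso G H -> amp_closure C G -> amp_closure C H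
| amp_dunion (G1 G2 : sgraph) :
    amp_closure C G1 -> amp_closure C G2 -> amp_closure C (dunion G1 G2)
| amp_one_join (G1 G2 : sgraph) (v1 : G1) (v2 : G2) :
    (3 <= #|G1|)%N -> (3 <= #|G2|)%N ->
    amp_closure C G1 -> amp_closure C G2 -> amp_closure C (one_join v1 v2).

Definition chi_bounding (R : realType) (C : graph_class) (f : nat -> R) : Prop :=
  forall G : sgraph, C G -> forall S : {set G},
    (chromatic_number (induced S))%:R <= f (clique_number (induced S)).

Definition polynomially_chi_bounded (R : realType) (C : graph_class) : Prop :=
  exists p : {poly R}, chi_bounding C (fun n => p.[n%:R]).

(* Main.v *)
Require Import Defs.
From mathcomp Require Import all_boot all_algebra reals.
From mathcomp Require Import all_order zify.

(** Fix a root [r] in a graph of the closure. Its vertices can be layered so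
    that [r] is alone in layer 0, layer 1 is its neighbourhood, and edges join
    equal or consecutive layers. In a 1-join with [r] on the side of [v1], lying
    in layer [D], the layers of the other side around [v2] are shifted by
    [D - 1]: layer [D] is then obtained by substituting the neighbourhood of
    [v2] for [v1], and every other layer is a disjoint union. So each layer arises
    from graphs of the original class by substitutions and disjoint unions, and
    colouring even and odd layers separately costs only a factor 2.

    If [chi <= omega ^ d] in the original class, then [chi <= omega ^ (d + 4)]
    under iterated substitution. For clique number [W] and fibers of clique
    number [w b], the outer vertices with [W %/ w b = m] have clique number at
    most [m], hence need at most [m ^ d * (W %/ m) ^ (d + 4)] colours. These
    palettes are disjoint for [m >= 2], and the fibers with [2 * w b > W], which
    are pairwise non-adjacent, recycle the palettes they cannot conflict with. *)

Set Implicit Arguments.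
Unset Strict Implicit.
Unset Printing Implicit Defensive.

(** * Colourings and cliques of vertex subsets, which stand for induced subgraphs *)

Definition set_colorable (G : sgraph) (A : {set G}) (k : nat) : Prop :=
  exists c : G -> nat, {in A, forall x, c x < k} /\
    {in A &, forall x y, adj x y -> c x != c y}.

Definition set_omega (G : sgraph) (A : {set G}) : nat :=
  \max_(K : {set G} | clique K && (K \subset A)) #|K|.

Lemma cliqueP (G : sgraph) (K : {set G}) :
  reflect {in K &, forall x y, x != y -> adj x y} (clique K).
Proof.
apply: (iffP forall_inP) => [H x y xK yK xy | H x xK].
  by have /forall_inP/(_ y yK)/implyP := H x xK; apply.
by apply/forall_inP => y yK; apply/implyP; apply: H.
Qed.

Section SetInvariants.
Variable G : sgraph.
Implicit Types A K : {set G}.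

Lemma set_colorable_leq A k l :
  k <= l -> set_colorable A k -> set_colorable A l.
Proof.
by move=> kl [c [cA cP]]; exists c; split=> // x /cA /leq_trans; apply.
Qed.

Lemma leq_set_omega A K : clique K -> K \subset A -> #|K| <= set_omega A.
Proof.
move=> cK KA; rewrite /set_omega.
by apply: (leq_bigmax_cond (P := fun K : {set G} => clique K && (K \subset A))); apply/andP.
Qed.

Lemma set_omegaP A : exists K, [/\ clique K, K \subset A & #|K| = set_omega A].
Proof.
rewrite /set_omega.
have H0 : clique (G := G) set0 && (set0 \subset A).
  by rewrite sub0set andbT; apply/cliqueP => x y; rewrite inE.
case: (eq_bigmax_cond (fun K : {set G} => #|K|) (A := fun K : {set G} => clique K && (K \subset A))).
  by apply/card_gt0P; exists set0.
by move=> K /andP[cK KA] E; exists K.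
Qed.

Lemma set_omegaS A A' : A' \subset A -> set_omega A' <= set_omega A.
Proof.
move=> sA; have [K [cK KA <-]] := set_omegaP A'.
exact: leq_set_omega cK (subset_trans KA sA).
Qed.

Lemma clique1 (x : G) : clique (G := G) [set x].
Proof. by apply/cliqueP => a b /set1P -> /set1P ->; rewrite eqxx. Qed.

Lemma clique2 (x y : G) : adj x y -> clique (G := G) [set x; y].
Proof.
move=> xy; apply/cliqueP => a b /set2P[]-> /set2P[]->; rewrite ?eqxx //.
by rewrite adj_sym.
Qed.

Lemma set_omega_gt0 A x : x \in A -> 0 < set_omega A.
Proof.
move=> xA; rewrite -(cards1 x); apply: leq_set_omega; first exact: clique1.
by rewrite sub1set.
Qed.

Lemma set_colorable_omega_le1 A : set_omega A <= 1 -> set_colorable A (set_omega A).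
Proof.
move=> W1; exists (fun=> 0); split=> [x /set_omega_gt0 //|x y xA yA xy].
have xDy : x != y by apply: contraTneq xy => ->; rewrite adj_irrefl.
have := leq_set_omega (clique2 xy) (A := A).
rewrite subUset !sub1set xA yA cards2 xDy => /(_ isT) /leq_trans /(_ W1).
by [].
Qed.

Lemma set_omega_induced A : clique_number (induced A) = set_omega A.
Proof.
apply/eqP; rewrite eqn_leq; apply/andP; split.
  apply/bigmax_leqP => K /cliqueP cK.
  rewrite -(card_imset _ val_inj); apply: leq_set_omega; last first.
    by apply/subsetP => _ /imsetP[x _ ->]; apply: (valP x).
  apply/cliqueP => _ _ /imsetP[x xK ->] /imsetP[y yK ->].
  by rewrite (inj_eq val_inj) => /(cK _ _ xK yK).
have [K [/cliqueP cK /subsetP KA <-]] := set_omegaP A.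
pose K' := [set x : induced A | val x \in K].
have -> : K = val @: K'.
  apply/setP => x; apply/idP/imsetP => [xK|[y]]; last by rewrite inE => yK ->.
  by exists (Sub x (KA x xK)); rewrite ?inE ?SubK.
rewrite (card_imset _ val_inj) /clique_number.
apply: (leq_bigmax_cond (P := @clique (induced A))).
apply/cliqueP => x y; rewrite !inE => xK yK xy.
by apply: cK; rewrite ?(inj_eq val_inj).
Qed.

Lemma chromatic_number_induced_leq A k :
  set_colorable A k -> chromatic_number (induced A) <= k.
Proof.
case=> c [cA cP]; rewrite /chromatic_number; case: ex_minnP => m _; apply.
apply/existsP; exists [ffun x => Ordinal (cA (val x) (valP x))].
apply/forallP => x; apply/forallP => y; apply/implyP => xy; rewrite !ffunE.
by rewrite -(inj_eq val_inj) /=; apply: cP xy; apply: valP.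
Qed.

Lemma set_colorable_chromatic A :
  set_colorable A (chromatic_number (induced A)).
Proof.
rewrite /chromatic_number; case: ex_minnP => m /existsP[c /forallP cP] _.
exists (fun x => if insub x is Some u then c u : nat else 0); split.
  by move=> x xA; rewrite insubT.
move=> x y xA yA xy; rewrite !insubT.
have /forallP/(_ (Sub y yA))/implyP := cP (Sub x xA).
by move=> /(_ xy); rewrite -(inj_eq val_inj).
Qed.

End SetInvariants.

(** * Power-bounded graphs and iterated substitution *)

Definition power_bounded (d : nat) (G : sgraph) : Prop :=
  forall A : {set G}, set_colorable A (set_omega A ^ d).

Definition fiber (X : finType) (T : eqType) (A : {set X}) (f : X -> T) (b : T) :=
  [set x in A | f x == b].

Definition modular_map (X Y : sgraph) (A : {set X}) (f : X -> Y) : Prop :=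
  {in A &, forall x y, f x != f y -> adj x y = adj (f x) (f y)}.

(* [modular d A]: the graph on [A] arises from [d]-power bounded graphs by
   iterated substitution; [f] collapses each substituted part to a vertex. *)
Inductive modular (d : nat) (X : sgraph) : {set X} -> Prop :=
| modular_small (A : {set X}) : #|A| <= 1 -> modular d A
| modular_node (A : {set X}) (B : sgraph) (f : X -> B) :
    power_bounded d B -> modular_map A f ->
    (forall b, modular d (fiber A f b)) -> modular d A.

Section Modular.
Variable d : nat.

(** Induction on the derivation of [modular d B]: if [g] collapses [B], then [g \o f] collapses [A],
    and [f] maps each fiber of [g \o f] into a fiber of [g], where the induction hypothesis
    applies. *)
Lemma modular_subst (X Y : sgraph) (A : {set X}) (B : {set Y}) (f : X -> Y) :
  modular d B -> {in A, forall x, f x \in B} -> modular_map A f ->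
  (forall b, b \in B -> modular d (fiber A f b)) -> modular d A.
Proof.
move=> mB; elim: mB A => {B} [B B1|B Z g Zd gB _ IH] A AB fA fibA.
  have [->|[x xA]] := set_0Vmem A; first by apply: modular_small; rewrite cards0.
  suff -> : A = fiber A f (f x) by apply/fibA/AB.
  apply/setP => y; rewrite inE; case yA: (y \in A) => //=; apply/esym/eqP.
  by move/card_le1_eqP: B1; apply; apply: AB.
have AP z : {in fiber A (g \o f) z, forall x, x \in A} by move=> x; rewrite inE => /andP[].
apply: (@modular_node _ _ _ Z (g \o f)) => // [x y xA yA /= gf|z].
  rewrite fA //; last by apply: contraNneq gf => ->.
  by apply: gB => //; apply: AB.
apply: (IH z) => [x|x y /AP xA /AP yA|b].
- by rewrite !inE => /andP[xA /= ->]; rewrite AB.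
- exact: fA.
- rewrite inE => /andP[bB /eqP gb].
  suff -> : fiber (fiber A (g \o f) z) f b = fiber A f b by apply: fibA.
  apply/setP => x; rewrite !inE /= -gb -andbA; case: (f x =P b) => [->|]; rewrite ?eqxx ?andbF //.
Qed.

(** Substituting single vertices shows that [modular] passes to induced subgraphs and isomorphic
    copies. *)
Lemma modular_inj (X Y : sgraph) (A : {set X}) (B : {set Y}) (f : X -> Y) :
  modular d B -> {in A, forall x, f x \in B} -> {in A &, injective f} ->
  {in A &, forall x y, adj x y = adj (f x) (f y)} -> modular d A.
Proof.
move=> mB AB fI fA; apply: modular_subst mB AB _ _ => [x y xA yA _|b _].
  exact: fA.
apply: modular_small; apply/card_le1_eqP => x y.
by rewrite !inE => /andP[xA /eqP <-] /andP[yA /eqP]; apply: fI.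
Qed.

Lemma modular_power_bounded (X : sgraph) (A : {set X}) :
  power_bounded d X -> modular d A.
Proof.
move=> Xd; apply: (@modular_node _ _ _ X id) => // b.
apply: modular_small; apply/card_le1_eqP => x y.
by rewrite !inE => /andP[_ /eqP ->] /andP[_ /eqP].
Qed.

Fact edgeless_sym : symmetric (fun _ _ : bool => false). Proof. by []. Qed.
Fact edgeless_irrefl : irreflexive (fun _ _ : bool => false). Proof. by []. Qed.
Definition edgeless2 : sgraph := SGraph edgeless_sym edgeless_irrefl.

Lemma edgeless2_power_bounded : power_bounded d edgeless2.
Proof.
move=> A; exists (fun=> 0); split=> // x /set_omega_gt0 W0.
by rewrite expn_gt0 W0.
Qed.

(** A disjoint union is a substitution into two non-adjacent vertices. *)
Lemma modular_split (X : sgraph) (A : {set X}) (s : X -> bool) :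
  {in A &, forall x y, s x -> ~~ s y -> ~~ adj x y} ->
  (forall b, modular d (fiber A s b)) -> modular d A.
Proof.
move=> sA; apply: (@modular_node _ _ _ edgeless2 s edgeless2_power_bounded).
move=> x y xA yA /=; case sx: (s x); case sy: (s y) => // _; apply/negbTE.
  by apply: sA => //; rewrite sy.
by rewrite adj_sym; apply: sA => //; rewrite sx.
Qed.

End Modular.

(* Telescoping, since [1/m^4 <= 1/(m+1) - 1/(m+2)] for [m >= 2]. *)
Lemma sum_divn_exp4 (W M n : nat) : 2 <= M ->
  (\sum_(M <= m < n) (W %/ m) ^ 4) * M.+1 <= W ^ 4.
Proof.
have [k] := ubnP (n - M); elim: k M => // k IH M lek M2.
have [nM|Mn] := leqP n M; first by rewrite big_geq.
rewrite big_ltn //; set a := W %/ M; set T := \sum_(_ <= _ < _) _.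
have HT : T * M.+2 <= W ^ 4 by apply: IH; lia.
have Ha : a ^ 4 * M ^ 4 <= W ^ 4.
  by rewrite -expnMn leq_exp2r // leq_divM.
have HM : M.+1 * M.+2 <= M ^ 4 by rewrite !expnS expn0; nia.
have Ha' : a ^ 4 * (M.+1 * M.+2) <= W ^ 4.
  by apply: leq_trans Ha; rewrite leq_mul2l HM orbT.
rewrite -(leq_pmul2r (ltn0Sn M.+1)).
move: (a ^ 4) (W ^ 4) HT Ha' => A B HT Ha'.
have := leq_mul (leqnn M.+1) HT.
lia.
Qed.

(** * Sizes of the palettes *)

Section Palettes.
Variables d W : nat.

Definition palette (m : nat) : nat := m ^ d * (W %/ m) ^ (d + 4).
(** Palettes are stacked with the largest index lowest: palette [m] occupies the colours from
    [palettes_from m.+1] up to [palettes_from m], excluded. *)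
Definition palettes_from (m : nat) : nat := \sum_(m <= j < W.+1) palette j.

Lemma palettes_fromS m : m <= W ->
  palettes_from m = palette m + palettes_from m.+1.
Proof. by move=> mW; rewrite /palettes_from big_ltn. Qed.

Lemma palettes_from_anti m n : m <= n -> palettes_from n <= palettes_from m.
Proof.
move=> mn; rewrite /palettes_from.
have [nW|Wn] := leqP n W.+1; last by rewrite (big_geq (ltnW Wn)).
by rewrite [X in _ <= X](big_cat_nat mn nW) /= leq_addl.
Qed.

Lemma palettes_from_leq m : 2 <= m -> palettes_from m * m.+1 <= W ^ (d + 4).
Proof.
move=> m2; apply: leq_trans (_ : W ^ d * ((\sum_(m <= j < W.+1) (W %/ j) ^ 4) * m.+1) <= _).
  rewrite mulnA leq_mul2r /= big_distrr /=.
  apply: leq_sum => j _; rewrite /palette expnD mulnA -expnMn leq_mul2r.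
  apply/orP; right; have [->|d0] := posnP d; first by rewrite !expn0.
  by rewrite leq_exp2r // mulnC leq_divM.
by rewrite expnD leq_mul2l sum_divn_exp4 ?orbT.
Qed.

(** Split [W ^ (d + 4)] into [k * W ^ (d + 3)] and [(W - k) * W ^ (d + 3)]. The first part has room
    for the palettes because [W <= (W %/ k).+1 * k]; the second bounds [(W - k) ^ (d + 4)]. *)
Lemma palettes_from_divn k : 0 < k -> 2 * k < W ->
  palettes_from (W %/ k) + (W - k) ^ (d + 4) <= W ^ (d + 4).
Proof.
move=> k0 kW.
have W0 : 0 < W by lia.
have M2 : 2 <= W %/ k by rewrite leq_divRL //; lia.
have HQ := palettes_from_leq M2.
have HW : W <= (W %/ k).+1 * k by apply: ltnW; apply: ltn_ceil.
move: (W %/ k) (palettes_from (W %/ k)) M2 HQ HW => M Q M2 HQ HW.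
have E : W ^ (d + 4) = W * W ^ (d + 3) by rewrite -expnS -addnS.
have QB : Q <= k * W ^ (d + 3).
  rewrite -(leq_pmul2l W0) [W * (k * _)]mulnCA -E.
  apply: leq_trans (_ : k * (Q * M.+1) <= _); last by rewrite leq_mul2l HQ orbT.
  by rewrite [k * _]mulnCA [k * _]mulnC [W * Q]mulnC leq_mul2l HW orbT.
have HB : (W - k) ^ (d + 4) <= (W - k) * W ^ (d + 3).
  rewrite addnS expnS leq_mul2l leq_exp2r ?leq_subr ?orbT //.
  by rewrite addnS.
apply: leq_trans (leq_add QB HB) _.
by rewrite -mulnDl subnKC ?E //; lia.
Qed.

End Palettes.

(** * Colouring a substitution *)

Section SubstitutionColoring.
Variables (d : nat) (X B : sgraph) (A : {set X}) (f : X -> B).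
Hypothesis gB : power_bounded d B.
Hypothesis fA : modular_map A f.
Let W := set_omega A.
Let w b := set_omega (fiber A f b).

(** Maximum cliques of the fibers over [K] are completely joined to each other, so their union is a
    clique. *)
Lemma sum_fiber_omega (K : {set B}) : clique K -> \sum_(b in K) w b <= W.
Proof.
move=> /cliqueP cK.
have /fin_all_exists[C CP] := fun b => set_omegaP (fiber A f b).
have CA b x : x \in C b -> (x \in A) /\ f x = b.
  have [_ /subsetP sC _] := CP b.
  by move=> /sC; rewrite inE => /andP[xA /eqP].
pose U := \bigcup_(b in K) C b.
have UP x : x \in U -> [/\ x \in A, f x \in K & x \in C (f x)].
  by case/bigcupP => b bK xC; have [xA fx] := CA _ _ xC; rewrite fx.
apply: leq_trans (_ : #|U| <= _).
  rewrite -sum1_card (partition_big f (mem K)) => [|x /UP[] //].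
  apply: leq_sum => b bK; have [_ _ Cb] := CP b; rewrite /w -Cb -sum1_card.
  rewrite [X in _ <= X](eq_bigl (mem (C b))) // => x /=.
  apply/andP/idP => [[/UP[_ _ xC] /eqP <-] //|xC].
  by have [xA ->] := CA _ _ xC; split=> //; apply/bigcupP; exists b.
apply: leq_set_omega; last by apply/subsetP => x /UP[].
apply/cliqueP => x y /UP[xA fxK xC] /UP[yA fyK yC] xy.
have [fxy|fxy] := eqVneq (f x) (f y); last by rewrite fA // cK.
have [/cliqueP cC _ _] := CP (f x).
by apply: cC => //; rewrite fxy.
Qed.

Lemma fiber_omega_leq b : w b <= W.
Proof. by have := sum_fiber_omega (clique1 b); rewrite big_set1. Qed.

Lemma fiber_omega_adj b b' : adj b b' -> w b + w b' <= W.
Proof.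
move=> bb'; have := sum_fiber_omega (clique2 bb').
rewrite big_setU1 ?big_set1 // inE.
by apply: contraTneq bb' => ->; rewrite adj_irrefl.
Qed.

Lemma fiber_omega_gt0 x : x \in A -> 0 < w (f x).
Proof. by move=> xA; apply: (@set_omega_gt0 _ _ x); rewrite inE xA eqxx. Qed.

Definition bucket (m : nat) : {set B} := [set b | (0 < w b) && (W %/ w b == m)].

(** Each [b] in the bucket has [W < w b * m.+1], so a clique of [m.+1] such vertices would have
    total weight above [W]. *)
Lemma bucket_omega m : set_omega (bucket m) <= m.
Proof.
have [K [cK /subsetP KB <-]] := set_omegaP (bucket m).
have H : #|K| * W.+1 <= W * m.+1.
  apply: leq_trans (_ : (\sum_(b in K) w b) * m.+1 <= _); last first.
    by rewrite leq_mul2r sum_fiber_omega ?orbT.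
  rewrite -sum_nat_const big_distrl /=; apply: leq_sum => b /KB.
  by rewrite inE => /andP[w0 /eqP <-]; rewrite mulnC ltn_ceil.
nia.
Qed.

Hypothesis fibA :
  forall b, set_colorable (fiber A f b) (w b ^ (d + 4)).

Lemma bucket_coloring : exists g : nat -> B -> nat, forall m, m <= W ->
  {in bucket m, forall b, g m b < m ^ d} /\
  {in bucket m &, forall b b', adj b b' -> g m b != g m b'}.
Proof.
have H (i : 'I_W.+1) : set_colorable (bucket i) (i ^ d).
  apply: set_colorable_leq (gB (bucket i)).
  have [->|d0] := posnP d; first by rewrite !expn0.
  by rewrite leq_exp2r // bucket_omega.
have /fin_all_exists[g gP] := H.
exists (fun m => g (inord m)) => m mW.
by have := gP (inord m); rewrite inordK.
Qed.

(* Fibers with [W %/ w b = m >= 2] are coloured inside palette [m]. A fiber with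
   [2 * w b > W] reuses the palettes of all buckets that it cannot see: with
   [k = W - w b], its neighbours [b'] have [w b' <= k], hence lie in buckets
   [m >= W %/ k]. *)
Lemma substitution_colorable : set_colorable A (W ^ (d + 4)).
Proof.
have [g gP] := bucket_coloring.
have /fin_all_exists[h hP] := fibA.
pose m b := W %/ w b.
pose Q := palettes_from d W.
(* For [2 <= m b] the fiber takes block [g (m b) b] of its palette. The case [W == w b] is separate
   because [W %/ 0 = 0]; such a fiber is adjacent to no nonempty fiber and can start at colour 0. *)
pose off b := if 2 <= m b then Q (m b).+1 + g (m b) b * (W %/ m b) ^ (d + 4)
              else if W == w b then 0 else Q (W %/ (W - w b)).
have mW b : m b <= W by apply: leq_div.
have wle b : w b <= W := fiber_omega_leq b.
have m_gt0 b : 0 < w b -> 0 < m b by move=> w0; rewrite divn_gt0.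
have w_m b : 0 < w b -> w b <= W %/ m b.
  by move=> w0; rewrite leq_divRL ?m_gt0 // mulnC leq_divM.
have m1 b : 0 < w b -> m b < 2 -> W < 2 * w b.
  move=> w0; rewrite ltnS => mb1; have := ltn_ceil W w0; rewrite -/(m b); nia.
have h_lt x : x \in A -> h (f x) x < w (f x) ^ (d + 4).
  by move=> xA; have [-> //] := hP (f x); rewrite inE xA eqxx.
have in_bucket x : x \in A -> f x \in bucket (m (f x)).
  by move=> xA; rewrite inE fiber_omega_gt0 ?eqxx.
have h_lt' x : x \in A -> h (f x) x < (W %/ m (f x)) ^ (d + 4).
  move=> xA; apply: leq_trans (h_lt x xA) _.
  by rewrite leq_exp2r ?w_m ?fiber_omega_gt0 // addnS.
have col_lt x : x \in A -> 2 <= m (f x) -> off (f x) + h (f x) x < Q (m (f x)).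
  move=> xA m2; rewrite /off m2 /Q (palettes_fromS d (mW _)) addnC addnA.
  rewrite [_ + palettes_from _ _ _]addnC [palette _ _ _ + _]addnC -addnA ltn_add2l /palette.
  have [/(_ _ (in_bucket x xA)) gx _] := gP _ (mW (f x)).
  have := h_lt' x xA; have := gx; set a := (W %/ _) ^ _.
  move: (g _ _) (_ ^ d) (h _ _) => u v t; clear; nia.
exists (fun x => off (f x) + h (f x) x); split=> [x xA|x y xA yA xy].
  have [m2|m2] := leqP 2 (m (f x)).
    apply: leq_trans (col_lt x xA m2) _.
    have := palettes_from_leq d W m2; rewrite -/Q; nia.
  have w0 := fiber_omega_gt0 xA.
  rewrite /off (leqNgt 2) m2 /=; case: eqP => [WE|/eqP WE].
    by rewrite add0n WE h_lt.
  have wW : w (f x) < W by rewrite ltn_neqAle eq_sym WE wle.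
  apply: leq_trans (@palettes_from_divn d W (W - w (f x)) _ _); last 2 first.
  - by rewrite subn_gt0.
  - by have := m1 _ w0 m2; lia.
  by rewrite subKn // ltn_add2l h_lt.
have [fxy|fxy] := eqVneq (f x) (f y).
  rewrite fxy eqn_add2l; have [_ hxy] := hP (f y).
  by apply: hxy => //; rewrite inE ?xA ?yA ?fxy eqxx.
wlog mxy : x y xA yA xy fxy / m (f x) <= m (f y).
  move=> WL; have [|/ltnW] := leqP (m (f x)) (m (f y)); first exact: WL.
  by move/(WL y x yA xA); rewrite adj_sym eq_sym [in X in _ -> _ -> X]eq_sym; apply.
have bb' : adj (f x) (f y) by rewrite -fA.
have ww := fiber_omega_adj bb'.
have wx := fiber_omega_gt0 xA; have wy := fiber_omega_gt0 yA.
(* Two adjacent fibers cannot both have clique number above [W / 2]. *)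
have m2 : 2 <= m (f y).
  rewrite leqNgt; apply/negP => m2.
  have := m1 _ wy m2; have := m1 _ wx (leq_ltn_trans mxy m2); lia.
have [mxyE|mxyN] := eqVneq (m (f x)) (m (f y)).
  have [_ gxy] := gP _ (mW (f y)).
  have /(_ (f x) (f y) _ _ bb') := gxy.
  rewrite -{1}mxyE !in_bucket // => /(_ isT isT).
  rewrite /off mxyE m2 -!addnA eqn_add2l.
  have := h_lt' x xA; have := h_lt' y yA; rewrite mxyE.
  set a := (W %/ _) ^ _; move: (g _ _) (g _ _) (h _ _) (h _ _) => u v s t; clear.
  move=> sa ta; apply: contraNneq => E.
  have a0 : 0 < a by apply: leq_trans sa.
  (* Division by the block length [a] recovers the block number. *)
  by move/(congr1 (divn^~ a)): E; rewrite /= !divnMDl // !divn_small // !addn0 => ->.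
have mlt : m (f x) < m (f y) by rewrite ltn_neqAle mxyN.
(* The larger index lies lower in the stack: the colour of [y] is below [Q (m (f y))], which is at
   most [off (f x)]. *)
rewrite eq_sym neq_ltn; apply/orP; left.
apply: leq_trans (col_lt y yA m2) _; apply: leq_trans (leq_addr _ _).
rewrite /off; case: ifP => [_|/negbT].
  by apply: leq_trans (leq_addr _ _); apply: palettes_from_anti.
rewrite -ltnNge => mx; case: eqP => [WE|/eqP WE]; first by move: ww wy; rewrite -WE; lia.
apply: palettes_from_anti; apply: leq_div2l => //; lia.
Qed.
End SubstitutionColoring.

(** Quantifying over the subsets [A'] lets the induction hypothesis apply to the fibers of [A'],
    which lie inside those of [A]. *)
Lemma modular_colorable d (X : sgraph) (A : {set X}) : modular d A ->
  forall A' : {set X}, A' \subset A -> set_colorable A' (set_omega A' ^ (d + 4)).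
Proof.
elim=> {A} [A A1 A' sA|A B f gB fA _ IH A' /subsetP sA].
  have W1 : set_omega A' <= 1.
    have [K [_ KA <-]] := set_omegaP A'.
    exact: leq_trans (subset_leq_card (subset_trans KA sA)) A1.
  apply: set_colorable_leq (set_colorable_omega_le1 W1).
  by case: (set_omega A') => // n; rewrite -{1}[n.+1]expn1 leq_pexp2l // addnS.
apply: (substitution_colorable (f := f) gB) => [x y /sA xA /sA yA|b].
  exact: fA.
by apply: (IH b); apply/subsetP => x; rewrite !inE => /andP[/sA ->].
Qed.

(* The layers need not be distance layers: layers 0, 1 and 2 suffice for a graph
   of the original class. *)
Definition layering (d : nat) (G : sgraph) (r : G) (l : G -> nat) : Prop :=
  [/\ forall x, (l x == 0) = (x == r),
      forall x, (l x == 1) = adj r x,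
      forall x y, adj x y -> l x <= (l y).+1
    & forall i, modular d [set x | l x == i]].

Definition layered (d : nat) (G : sgraph) : Prop :=
  forall r : G, exists l, layering d r l.

(** * Layerings of the graphs in the closure *)

Section Layered.
Variable d : nat.

Lemma modular_image (X Y : sgraph) (B : {set Y}) (h : Y -> X) :
  modular d B -> injective h -> (forall x y, adj (h x) (h y) = adj x y) ->
  modular d (h @: B).
Proof.
move=> mB hI hA; have [->|[y0 _]] := set_0Vmem B.
  by apply: modular_small; rewrite imset0 cards0.
pose g x := odflt y0 [pick y | h y == x].
have hK y : g (h y) = y.
  by rewrite /g; case: pickP => [z /eqP /hI //|/(_ y)]; rewrite eqxx.
apply: (modular_inj mB (f := g)) => [x|x z|x z] /imsetP[y yB ->].
- by rewrite hK.
- by move=> /imsetP[w _ ->]; rewrite !hK => ->.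
- by move=> /imsetP[w _ ->]; rewrite !hK hA.
Qed.

Lemma power_bounded_layered (G : sgraph) : power_bounded d G -> layered d G.
Proof.
move=> Gd r; exists (fun x => if x == r then 0 else if adj r x then 1 else 2).
split=> [x|x|x y|i]; last exact: modular_power_bounded.
- by case: (x =P r) => //; case: ifP.
- by case: (x =P r) => [->|_]; [rewrite adj_irrefl | case: ifP].
case: (x =P r) => // _; case: (y =P r) => [-> xr|_ _]; last by do 2!case: ifP.
by rewrite adj_sym xr.
Qed.

Lemma layering_iso (G H : sgraph) (f : G -> H) (g : H -> G) (r : H) (l : G -> nat) :
  cancel f g -> cancel g f -> (forall x y, adj (f x) (f y) = adj x y) ->
  layering d (g r) l -> layering d r (l \o g).
Proof.
move=> fK gK fA [l0 l1 lA lM].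
have gA x y : adj (g x) (g y) = adj x y by rewrite -fA !gK.
split=> [x|x|x y|i] /=.
- by rewrite l0 (can_eq gK).
- by rewrite l1 gA.
- by rewrite -gA; apply: lA.
- apply: (modular_inj (lM i) (f := g)) => [x|x y _ _|x y _ _]; rewrite ?inE ?gA //.
  exact: (can_inj gK).
Qed.

Lemma layered_iso (G H : sgraph) : graph_iso G H -> layered d G -> layered d H.
Proof.
case=> f [g fK gK] fA lG r; have [l lP] := lG (g r).
by exists (l \o g); apply: layering_iso lP.
Qed.

(** Serves the component that does not contain the root. An empty graph has no root to choose, hence
    the case distinction. *)
Lemma layered_unrooted (G : sgraph) : layered d G -> exists l : G -> nat,
  (forall x y, adj x y -> l x <= (l y).+1) /\
  (forall i, modular d [set x | l x == i]).
Proof.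
move=> lG; have [G0|[r _]] := set_0Vmem [set: G]; last first.
  by have [l [_ _ lA lM]] := lG r; exists l.
exists (fun=> 0); split=> // i; apply: modular_small.
by apply: leq_trans (subset_leq_card (subsetT _)) _; rewrite G0 cards0.
Qed.

Lemma dunion_layering_inl (G1 G2 : sgraph) (r : G1) :
  layered d G1 -> layered d G2 ->
  exists l, layering d (inl r : dunion G1 G2) l.
Proof.
move=> L1 L2; have [l1 [l10 l11 l1A l1M]] := L1 r.
have [l2 [l2A l2M]] := layered_unrooted L2.
(* The shift by 2 keeps the component without the root off layers 0 and 1. *)
pose l (x : dunion G1 G2) := match x with inl a => l1 a | inr b => (l2 b).+2 end.
exists l; split=> [[a|b]|[a|b]|[a|b] [a'|b'] //=|i] //=.
- exact: l1A.
- exact: l2A.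
apply: (@modular_split _ _ _ (fun x : dunion G1 G2 => if x is inl _ then true else false)).
  by move=> [a|b] [a'|b'].
have mI1 := modular_image (h := inl : G1 -> dunion G1 G2) (l1M i) inl_inj (fun _ _ => erefl).
have mI2 := modular_image (h := inr : G2 -> dunion G1 G2) (l2M (i - 2)) inr_inj (fun _ _ => erefl).
case.
  apply: (modular_inj mI1 (f := id)) => // x; rewrite !inE => /andP[].
  by case: x => // a /= la _; apply: imset_f; rewrite inE.
apply: (modular_inj mI2 (f := id)) => // x; rewrite !inE => /andP[].
by case: x => // b /= /eqP <- _; apply: imset_f; rewrite inE subn2.
Qed.

Lemma layered_dunion (G1 G2 : sgraph) :
  layered d G1 -> layered d G2 -> layered d (dunion G1 G2).
Proof.
move=> L1 L2 [r|r]; first exact: dunion_layering_inl.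
have [l lP] := dunion_layering_inl r L2 L1.
pose swap (A B : Type) (x : A + B) := match x with inl a => inr a | inr b => inl b end.
exists (l \o @swap G1 G2).
apply: (@layering_iso (dunion G2 G1) (dunion G1 G2) (@swap G2 G1)) lP.
- by case.
- by case.
- by move=> [a|b] [a'|b'].
Qed.

(* One side of a 1-join: [s] marks the vertices of [X] coming from [G1], and
   [f1] (resp. [f2]) collapses the other side to the marker [v1] (resp. [v2]). *)
Lemma one_join_layering (X G1 G2 : sgraph) (v1 : G1) (v2 : G2) (s : pred X)
    (f1 : X -> G1) (f2 : X -> G2) (r : X) :
  layered d G1 -> layered d G2 ->
  {in s, forall x, f1 x != v1} -> {in predC s, forall x, f1 x = v1} ->
  {in predC s, forall x, f2 x != v2} ->
  {in s &, injective f1} -> {in predC s &, injective f2} ->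
  {in s &, forall x y, adj x y = adj (f1 x) (f1 y)} ->
  {in predC s &, forall x y, adj x y = adj (f2 x) (f2 y)} ->
  {in s & predC s, forall x y, adj x y = adj v1 (f1 x) && adj v2 (f2 y)} ->
  s r -> exists l, layering d r l.
Proof.
move=> L1 L2 s1 s1' s2 I1 I2 A1 A2 A12 sr.
have [l1 [l10 l11 l1A l1M]] := L1 (f1 r).
have [l2 [l20 l21 l2A l2M]] := L2 v2.
have A21 x y : ~~ s x -> s y -> adj x y = adj v1 (f1 y) && adj v2 (f2 x).
  by move=> sx sy; rewrite adj_sym A12.
pose D := l1 v1.
have D0 : 0 < D by rewrite lt0n l10 eq_sym s1.
have l2_gt0 x : ~~ s x -> 0 < l2 (f2 x) by move=> sx; rewrite lt0n l20 s2.
(* The other side starts at layer [D]: its values of [l2] are positive, since only [v2] has value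
   0. *)
pose l x := if s x then l1 (f1 x) else l2 (f2 x) + D.-1.
exists l; split=> [x|x|x y xy|i].
- rewrite /l; case: ifPn => sx; first by rewrite l10 (inj_in_eq I1).
  have -> : (x == r) = false by apply: contraNF sx => /eqP ->.
  by have := l2_gt0 x sx; lia.
- rewrite /l; case: ifPn => sx; first by rewrite l11 A1.
  (* Off [s], the layer is 1 exactly when [D] and [l2 (f2 x)] are both 1, that is, when [v1] is
     adjacent to [f1 r] and [v2] to [f2 x]. *)
  rewrite A12 // [adj v1 _]adj_sym -l11 -l21 -/D.
  by have := l2_gt0 x sx; case: eqP => [E|E]; case: eqP; case: eqP => //=; lia.
- rewrite /l; case: (boolP (s x)) xy => sx; case: (boolP (s y)) => sy.
  + by rewrite A1 //; apply: l1A.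
  + rewrite A12 // -l21 => /andP[v1x /eqP ->].
    by have := l1A _ _ v1x; have := l1A (f1 x) v1; rewrite adj_sym => /(_ v1x); rewrite -/D; lia.
  + rewrite A21 // -l21 => /andP[v1y /eqP ->].
    by have := l1A _ _ v1y; rewrite -/D; lia.
  + by rewrite A2 // => /l2A; lia.
have [iD|iD] := eqVneq i D.
  have AP x : (x \in [set x | l x == i]) = if s x then l1 (f1 x) == D else adj v2 (f2 x).
    rewrite inE iD /l; case: ifPn => // sx.
    by rewrite -l21; have := l2_gt0 x sx; lia.
  apply: (modular_subst (l1M D) (f := f1)) => [x|x y|b _].
  + by rewrite AP inE; case: ifPn => // sx _; rewrite s1'.
  + rewrite !AP; case: ifPn => sx xA; case: ifPn => sy yA.
    * by rewrite A1.
    * by rewrite A12 // yA andbT (s1' y) // adj_sym.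
    * by rewrite A21 // xA andbT (s1' x).
    * by rewrite !s1' ?eqxx.
  (* The fiber over [v1] embeds in the neighbourhood of [v2], which is layer 1 of [l2]; every other
     fiber has at most one vertex. *)
  have [->|bv1] := eqVneq b v1.
    have FP x : x \in fiber [set x | l x == i] f1 v1 ->
        ~~ s x /\ adj v2 (f2 x).
      rewrite inE AP => /andP[]; case: ifPn => [/s1 /negbTE -> //|//].
    apply: (modular_inj (l2M 1) (f := f2)) => [x|x y|x y].
    * by case/FP => _; rewrite inE l21.
    * by case/FP => sx _ /FP[sy _]; apply: I2.
    * by case/FP => sx _ /FP[sy _]; apply: A2.
  apply: modular_small; apply/card_le1_eqP => x y; rewrite !inE.
  case/andP=> _ /eqP fx /andP[_ /eqP fy].
  have sP z : f1 z = b -> s z by move=> fz; apply: contraTT isT => /s1'; move/eqP: bv1; congruence.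
  by apply: I1; rewrite ?fx ?fy //; apply: sP.
(* An edge between the sides has its far end in layer [D], so within any other layer the sides are
   not adjacent. *)
apply: (@modular_split _ _ _ s) => [x y|b].
  rewrite !inE => _ yi sx sy; rewrite /l (negbTE sy) in yi.
  by rewrite A12 // -l21; apply: contraNN iD => /andP[_ /eqP E]; rewrite -(eqP yi) E; lia.
case: b.
  have FP x : x \in fiber [set x | l x == i] s true -> s x /\ l1 (f1 x) == i.
    by rewrite !inE /l => /andP[+ /eqP sx]; rewrite sx.
  apply: (modular_inj (l1M i) (f := f1)) => [x|x y|x y].
  + by case/FP => _; rewrite inE.
  + by case/FP => sx _ /FP[sy _]; apply: I1.
  + by case/FP => sx _ /FP[sy _]; apply: A1.
have FP x : x \in fiber [set x | l x == i] s false -> ~~ s x /\ l2 (f2 x) == i.+1 - D.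
  by rewrite !inE /l => /andP[+ /eqP sx]; rewrite sx => E; split=> //; move: E; lia.
apply: (modular_inj (l2M (i.+1 - D)) (f := f2)) => [x|x y|x y].
- by case/FP => _; rewrite inE.
- by case/FP => sx _ /FP[sy _]; apply: I2.
- by case/FP => sx _ /FP[sy _]; apply: A2.
Qed.

Lemma layered_one_join (G1 G2 : sgraph) (v1 : G1) (v2 : G2) :
  layered d G1 -> layered d G2 -> layered d (one_join v1 v2).
Proof.
move=> L1 L2 r.
pose s (x : one_join v1 v2) := if val x is inl _ then true else false.
pose f1 (x : one_join v1 v2) := if val x is inl a then a else v1.
pose f2 (x : one_join v1 v2) := if val x is inr b then b else v2.
have s1 : {in s, forall x, f1 x != v1}.
  by rewrite /s /f1 => -[[a|b] xP] // _; have := xP; rewrite !inE orbF.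
have s2 : {in predC s, forall x, f2 x != v2}.
  by rewrite /s /f2 => -[[a|b] xP] // _; have := xP; rewrite !inE.
have I1 : {in s &, injective f1}.
  by rewrite /s /f1 => -[[a|b] xP] // -[[a'|b'] yP] // _ _ /= E; apply: val_inj; rewrite /= E.
have I2 : {in predC s &, injective f2}.
  by rewrite /s /f2 => -[[a|b] xP] // -[[a'|b'] yP] // _ _ /= E; apply: val_inj; rewrite /= E.
case: (boolP (s r)) => sr.
  apply: (one_join_layering (v1 := v1) (v2 := v2) (s := s) (f1 := f1) (f2 := f2) L1 L2) => //.
  - by rewrite /s /f1 => -[[a|b] xP].
  - by rewrite /s /f1 => -[[a|b] xP] // -[[a'|b'] yP].
  - by rewrite /s /f2 => -[[a|b] xP] // -[[a'|b'] yP].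
  - by rewrite /s /f1 /f2 => -[[a|b] xP] -[[a'|b'] yP].
(* With the root on the side of [G2], the two graphs exchange roles. *)
have sK x : (x \in predC (predC s)) = s x by rewrite !inE negbK.
apply: (one_join_layering (v1 := v2) (v2 := v1) (s := predC s) (f1 := f2) (f2 := f1) L2 L1) => //.
- by rewrite /s /f2 => -[[a|b] xP].
- by move=> x; rewrite sK; apply: s1.
- by move=> x y; rewrite !sK; apply: I1.
- by rewrite /s /f2 => -[[a|b] xP] // -[[a'|b'] yP].
- by rewrite /s /f1 => -[[a|b] xP] // -[[a'|b'] yP].
- by rewrite /s /f1 /f2 => -[[a|b] xP] -[[a'|b'] yP] //= _ _; rewrite andbC.
Qed.

Lemma amp_closure_layered (C : graph_class) (G : sgraph) :
  (forall G, C G -> power_bounded d G) -> amp_closure C G -> layered d G.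
Proof.
move=> Cd; elim=> {G} [G /Cd|G H GH _|G1 G2 _ L1 _ L2|G1 G2 v1 v2 _ _ _ L1 _ L2].
- exact: power_bounded_layered.
- exact: layered_iso.
- exact: layered_dunion.
- exact: layered_one_join.
Qed.

Lemma layered_colorable (G : sgraph) (A : {set G}) :
  layered d G -> set_colorable A (2 * set_omega A ^ (d + 4)).
Proof.
case/layered_unrooted => l [lA lM].
have mono i : set_omega (fiber A l i) <= set_omega A.
  by apply: set_omegaS; apply/subsetP => x; rewrite inE => /andP[].
have H (i : 'I_(\max_x l x).+1) : set_colorable (fiber A l i) (set_omega A ^ (d + 4)).
  apply: set_colorable_leq (modular_colorable (lM i) _).
    by rewrite leq_exp2r ?mono // addnS.
  by apply/subsetP => x; rewrite !inE => /andP[].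
have /fin_all_exists[c cP] := H.
have {}cP i : i <= \max_x l x ->
    {in fiber A l i, forall x, c (inord i) x < set_omega A ^ (d + 4)} /\
    {in fiber A l i &, forall x y, adj x y -> c (inord i) x != c (inord i) y}.
  by move=> iN; have := cP (inord i); rewrite inordK.
have lN x : l x <= \max_x l x by apply: leq_bigmax.
have fib x : x \in A -> x \in fiber A l (l x) by move=> xA; rewrite inE xA /=.
(* The last bit records the parity of the layer, which separates consecutive layers; the rest
   colours each layer. *)
exists (fun x => 2 * c (inord (l x)) x + odd (l x)).
split=> [x xA|x y xA yA xy].
  have [/(_ _ (fib x xA)) + _] := cP _ (lN x); have := leq_b1 (odd (l x)); lia.
have [lxy|lxy] := eqVneq (l x) (l y).
  have [_ /(_ x y _ _ xy)] := cP _ (lN y).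
  by rewrite -{1}lxy !fib // lxy => /(_ isT isT); lia.
have lxy1 := lA _ _ xy; have lyx1 : l y <= (l x).+1 by apply: lA; rewrite adj_sym.
have E : odd (l x) = ~~ odd (l y).
  have [->|->] : l x = (l y).+1 \/ l y = (l x).+1 by lia.
    by [].
  by rewrite /= negbK.
by rewrite E; case: (odd _) => /=; lia.
Qed.

End Layered.

(** * From polynomial bounds to pure powers *)

Section PolynomialBounds.
Import Order.TTheory GRing.Theory Num.Theory.
Local Open Scope ring_scope.

(** With [s] the sum of the absolute values of the coefficients, [p.[n%:R]] is at most
    [s * n ^ size p], and [s <= e <= 2 ^ e <= n ^ e]; the last inequality uses [1 < n]. *)
Lemma poly_natr_leq_expn (R : realType) (p : {poly R}) :
  exists d, forall n k : nat, (1 < n)%N -> k%:R <= p.[n%:R] -> (k <= n ^ d)%N.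
Proof.
pose s : R := \sum_(i < size p) `|p`_i|.
pose e := Num.bound s.
have s0 : 0 <= s by apply: sumr_ge0.
exists (e + size p)%N => n k n1 kp.
have n1R : (1 : R) <= n%:R by rewrite ler1n ltnW.
suff : (k%:R : R) <= (n ^ (e + size p))%:R by rewrite ler_nat.
apply: (le_trans kp); apply: le_trans (_ : s * n%:R ^+ size p <= _).
  rewrite horner_coef /s mulr_suml; apply: ler_sum => i _.
  apply: le_trans (ler_norm _) _; rewrite normrM normrX normr_nat.
  by rewrite ler_wpM2l // ler_weXn2l // ltnW.
rewrite expnD natrM [(n ^ size p)%:R]natrX ler_wpM2r ?exprn_ge0 //.
apply: le_trans (ltW (archi_boundP s0)) _.
rewrite ler_nat; apply: leq_trans (ltnW (ltn_expl e (ltnSn 1))) _.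
by case: e => // e'; rewrite leq_exp2r.
Qed.

Lemma polynomially_chi_bounded_power (R : realType) (C : graph_class) :
  polynomially_chi_bounded R C ->
  exists d, forall G, C G -> power_bounded d G.
Proof.
case=> p pP; have [d dP] := poly_natr_leq_expn p.
exists d.+1 => G /pP GP A.
(* [dP] speaks of clique numbers from 2 on; below that [A] spans no edge and is coloured
   directly. *)
have [W1|W1] := leqP (set_omega A) 1.
  apply: set_colorable_leq (set_colorable_omega_le1 W1).
  by case: (set_omega A) W1 => [|[]] //; rewrite exp1n.
apply: set_colorable_leq (set_colorable_chromatic A).
apply: leq_trans (dP _ _ W1 _) _; last by rewrite leq_exp2l.
by have := GP A; rewrite set_omega_induced.
Qed.

End PolynomialBounds.

Theorem theorem1p2 (R : realType) (C : graph_class) :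
  polynomially_chi_bounded R C -> polynomially_chi_bounded R (amp_closure C).
Proof.
case/polynomially_chi_bounded_power => d Cd.
exists (2 *: 'X^(d + 4))%R => G /(amp_closure_layered Cd) lG A.
rewrite hornerZ hornerXn -GRing.natrX -GRing.natrM Num.Theory.ler_nat set_omega_induced.
exact: chromatic_number_induced_leq (layered_colorable A lG).
Qed.
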